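(* Let $q$ be a prime power and let $n$ be a positive integer with $\gcd(n,q)=1$. Let $\operatorname{Aut}_q(n):=\operatorname{Aut}\big(\operatorname{Cyc}(\langle q\rangle,\mathbb{Z}_n)\big)$ be the automorphism group of the cyclotomic association scheme of the subgroup $\langle q\rangle\le\mathbb{Z}_n^\times$ acting on $\mathbb{Z}_n$ by multiplication. Then $$\bigcap_{C}\operatorname{PAut}(C)=\operatorname{Aut}_q(n),$$ where $C$ runs over all cyclic codes of length $n$ over $\mathbb{F}_q$.
   Context: Write $\mathbb{Z}_n=\mathbb{Z}/n\mathbb{Z}$ and $\Omega:=\mathbb{Z}_n$. Let $\langle q\rangle$ be the subgroup of $\mathbb{Z}_n^\times$ generated by $q$, and for $a\in\mathbb{Z}_n$ let $a\langle q\rangle=\{ak:k\in\langle q\rangle\}$ be its orbit under multiplication. The cyclotomic association scheme $\operatorname{Cyc}(\langle q\rangle,\mathbb{Z}_n)$ is the pair $(\mathbb{Z}_n,\pi)$, where $\pi$ is the coloring of ordered pairs by orbits, $\pi(x,y):=(y-x)\langle q\rangle$ for $x,y\in\mathbb{Z}_n$. Its automorphism group is the group of all permutations $\sigma\in\operatorname{Sym}(\mathbb{Z}_n)$ with $\pi(\sigma x,\sigma y)=\pi(x,y)$ for all $x,y\in\mathbb{Z}_n$. The space $\mathbb{F}_q^\Omega$ of functions $\Omega\to\mathbb{F}_q$ is an $\mathbb{F}_q$-algebra under convolution $(f*g)(x)=\sum_{y\in\Omega}f(x-y)g(y)$. A cyclic code of length $n$ over $\mathbb{F}_q$ is an ideal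 of this algebra (equivalently, a subspace closed under the cyclic shift). The group $\operatorname{Sym}(\Omega)$ acts on $\mathbb{F}_q^\Omega$ by $(\sigma c)(i)=c(\sigma^{-1}i)$, and $\operatorname{PAut}(C):=\{\sigma\in\operatorname{Sym}(\Omega):\sigma C=C\}$. *)

(* Defs.v *)
From HB Require Import structures.
From mathcomp Require Import all_boot all_order all_fingroup all_algebra.

Set Implicit Arguments.
Unset Strict Implicit.
Unset Printing Implicit Defensive.

Import GroupScope GRing.Theory.
Local Open Scope ring_scope.

(* Z/nZ for n > 0; unlike 'Z_n this has one element when n = 1.  The additive
   structure is the canonical one on 'I_m.+1; multiplication is Zp_mul, since
   the trivial ring 'I_1 has no canonical ring structure. *)
Notation Zmod n := 'I_n.-1.+1.

Section UnitGroup.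

Variable n : nat.

Record Zunits := ZUnit { Zunit_val :> Zmod n; _ : coprime n.-1.+1 Zunit_val }.

HB.instance Definition _ := [isSub for Zunit_val].
HB.instance Definition _ := [Finite of Zunits by <:].

Implicit Types u v : Zunits.

Lemma Zunit_mul_subproof u v :
  coprime n.-1.+1 (Zp_mul (u : Zmod n) (v : Zmod n)).
Proof. by rewrite coprime_modr coprimeMr (valP u) (valP v). Qed.

Lemma Zunit_one_subproof : coprime n.-1.+1 (Zp1 : Zmod n).
Proof. by rewrite coprime_modr coprimen1. Qed.

Lemma Zunit_inv_subproof u : coprime n.-1.+1 (Zp_inv (u : Zmod n)).
Proof. exact: Zp_intro_unit (Zp_mulzV (valP u)). Qed.

Definition Zunit_mul u v : Zunits := ZUnit (Zunit_mul_subproof u v).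
Definition Zunit_one : Zunits := ZUnit Zunit_one_subproof.
Definition Zunit_inv u : Zunits := ZUnit (Zunit_inv_subproof u).

Lemma Zunit_mulA : associative Zunit_mul.
Proof. by move=> u v w; apply/val_inj/Zp_mulA. Qed.

Lemma Zunit_mul1 : left_id Zunit_one Zunit_mul.
Proof. by move=> u; apply/val_inj/Zp_mul1z. Qed.

Lemma Zunit_mulV : left_inverse Zunit_one Zunit_inv Zunit_mul.
Proof. by move=> u; apply/val_inj/(Zp_mulVz (valP u)). Qed.

HB.instance Definition _ :=
  Finite_isGroup.Build Zunits Zunit_mulA Zunit_mul1 Zunit_mulV.

Lemma Zunit_nat_subproof q : coprime n q -> coprime n.-1.+1 (inZp q : Zmod n).
Proof. by case: n => [|m] co_mq; rewrite coprime_modr // coprime1n. Qed.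

Definition Zunit_nat q (co_nq : coprime n q) : Zunits :=
  ZUnit (Zunit_nat_subproof co_nq).

Definition Zorbit (K : {set Zunits}) (a : Zmod n) : {set Zmod n} :=
  [set Zp_mul a (val k) | k in K].

End UnitGroup.

Definition Cyc n (K : {group Zunits n}) (x y : Zmod n) : {set Zmod n} :=
  Zorbit K (y - x).

Definition colorAut (T : finType) (color : eqType) (pi : T -> T -> color) :
    {set {perm T}} :=
  [set s : {perm T} | [forall x, forall y, pi (s x) (s y) == pi x y]].

Definition Aut_q n q (co_nq : coprime n q) : {set {perm Zmod n}} :=
  colorAut (Cyc <[Zunit_nat co_nq]>).

Section CyclicCodes.

Variables (n : nat) (F : finFieldType).
Implicit Types (f g c : {ffun Zmod n -> F}) (C : {set {ffun Zmod n -> F}}).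

(* The canonical product on {ffun _ -> F} is pointwise, hence not this one. *)
Definition convolution f g : {ffun Zmod n -> F} :=
  [ffun x => \sum_y f (x - y) * g y].

Definition linear_code C : bool :=
  (0 \in C) && [forall a : F, forall f in C, forall g in C,
                  [ffun x => a * f x + g x] \in C].

(* Ideals are one-sided here because convolution is commutative. *)
Definition cyclic_code C : bool :=
  linear_code C && [forall f, forall g in C, convolution f g \in C].

Definition perm_word (s : {perm Zmod n}) c : {ffun Zmod n -> F} :=
  [ffun i => c (s^-1%g i)].

Definition PAut C : {set {perm Zmod n}} :=
  [set s : {perm Zmod n} | [set perm_word s c | c in C] == C].

End CyclicCodes.

(* Main.v *)
(* Cyclic codes are the ideals of the group algebra A = F[Z_n].  Comparing
   coefficients, (f^q)(q x) = f(x), so f^q = f exactly when f is constant on the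
   <q>-orbits.  Idempotents satisfy e^q = e; conversely, since X^q = X on F,
   Lagrange interpolation writes every f with f^q = f as
   f = sum_a a (1 - (f - a)^(q-1)), a combination of idempotents.  A permutation
   stabilizing the ideals e A and (1 - e) A commutes with convolution by e, hence
   satisfies f (s x - s y) = f (x - y) for all f constant on orbits, in particular
   for the indicator of each orbit.  Conversely, if s preserves the orbit
   coloring then it commutes with convolution by idempotents; as q^t = 1 mod n
   for t = totient n, each c satisfies c^(q^t) = c, so e = c^(q^t - 1) is an
   idempotent of the ideal c A with e c = c, and s c = e (s c) stays in c A. *)
From HB Require Import structures.
From mathcomp Require Import all_boot all_order all_fingroup all_algebra.
From mathcomp Require Import cyclic finfield.
Require Import Defs.

Set Implicit Arguments.
Unset Strict Implicit.
Unset Printing Implicit Defensive.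

Import GRing.Theory.
Local Open Scope ring_scope.

(* An alias, because {ffun G -> R} already has the pointwise product. *)
Definition group_alg (R : comNzRingType) (G : finZmodType) := {ffun G -> R}.

HB.instance Definition _ R G := GRing.Zmodule.on (group_alg R G).

(** * The group algebra of a finite abelian group, with convolution as product *)

Section GroupAlgebra.

Variables (R : comNzRingType) (G : finZmodType).
Local Notation A := (group_alg R G).
Implicit Types (f g h : A) (a b : R) (x y z : G).

Definition conv f g : A := [ffun x => \sum_y f (x - y) * g y].

Definition monom a x : A := [ffun y => a *+ (y == x)].

Lemma convC : commutative conv.
Proof.
move=> f g; apply/ffunP=> x; rewrite !ffunE.
rewrite (reindex_inj (inv_inj (subKr x))) /=.
by apply: eq_bigr => y _; rewrite subKr mulrC.
Qed.

Lemma convA : associative conv.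
Proof.
move=> f g h; apply/ffunP=> x; rewrite !ffunE.
under eq_bigr do rewrite ffunE mulr_sumr.
rewrite exchange_big /=; apply: eq_bigr => z _; rewrite ffunE mulr_suml.
rewrite (reindex_inj (addIr z)) /=.
by apply: eq_bigr => y _; rewrite addrK mulrA opprD addrA addrAC.
Qed.

Lemma conv_monom f a x z : conv f (monom a x) z = f (z - x) * a.
Proof.
rewrite ffunE (bigD1 x) //= ffunE eqxx mulr1n big1 ?addr0 // => y.
by rewrite ffunE => /negPf ->; rewrite mulr0n mulr0.
Qed.

Lemma conv1 : left_id (monom 1 0) conv.
Proof. by move=> f; apply/ffunP=> x; rewrite convC conv_monom subr0 mulr1. Qed.

Lemma convDl : left_distributive conv +%R.
Proof.
move=> f g h; apply/ffunP=> x; rewrite !ffunE -big_split /=.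
by apply: eq_bigr => y _; rewrite ffunE mulrDl.
Qed.

Lemma monom1_neq0 : monom 1 0 != 0.
Proof. by apply/eqP=> /ffunP/(_ 0)/eqP; rewrite !ffunE eqxx oner_eq0. Qed.

HB.instance Definition _ := GRing.Zmodule_isComNzRing.Build A
  convA convC conv1 convDl monom1_neq0.

Lemma monomM a b x y : monom a x * monom b y = monom (a * b) (x + y) :> A.
Proof.
by apply/ffunP=> z; rewrite conv_monom !ffunE subr_eq mulrnAl.
Qed.

Lemma monomX a x k : (monom a x : A) ^+ k = monom (a ^+ k) (x *+ k).
Proof. by elim: k => // k IHk; rewrite exprS IHk monomM -exprS -mulrS. Qed.

Lemma sum_monom f : f = \sum_x monom (f x) x.
Proof.
apply/ffunP=> y; rewrite sum_ffunE (bigD1 y) //= ffunE eqxx mulr1n.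
by rewrite big1 ?addr0 // => x; rewrite ffunE eq_sym => /negPf ->.
Qed.

Definition scalar a : A := monom a 0.

Lemma scalar_is_zmod_morphism : zmod_morphism scalar.
Proof. by move=> a b; apply/ffunP=> x; rewrite !ffunE mulrnBl. Qed.

Lemma scalar_is_monoid_morphism : monoid_morphism scalar.
Proof. by split=> // a b; rewrite monomM addr0. Qed.

HB.instance Definition _ :=
  GRing.isZmodMorphism.Build R A scalar scalar_is_zmod_morphism.
HB.instance Definition _ :=
  GRing.isMonoidMorphism.Build R A scalar scalar_is_monoid_morphism.

Lemma mul_scalar a f x : (scalar a * f) x = a * f x.
Proof. by rewrite [_ * _]mulrC conv_monom subr0 mulrC. Qed.

End GroupAlgebra.

(** The difference of the two sides has degree below [#|F|] and vanishes on all of [F], since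
    [1 - (b - a) ^+ #|F|.-1] is 1 if [b = a] and 0 otherwise. *)
Lemma polyX_lagrange (F : finFieldType) :
  'X = \sum_(a : F) a%:P * (1 - ('X - a%:P) ^+ #|F|.-1) :> {poly F}.
Proof.
have F_gt1 := card_finNzRing_gt1 F.
apply/eqP; rewrite -subr_eq0; apply/eqP.
apply: (@roots_geq_poly_eq0 _ _ (enum F)); rewrite ?enum_uniq //.
- apply/allP=> b _; rewrite rootE !hornerE horner_sum (bigD1 b) //= big1.
    (* Writing [#|F|] as 2 plus a remainder shows that the exponent [#|F|.-1] is nonzero, so the
       power of 0 vanishes. *)
    rewrite !hornerE subrr expr0n -(subnKC F_gt1) /=.
    by rewrite subr0 mulr1 subrr.
  move=> a neq_ab; rewrite !hornerE.
  have ba_neq0 : b - a != 0 by rewrite subr_eq0 eq_sym.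
  suff -> : (b - a) ^+ #|F|.-1 = 1 by rewrite subrr mulr0.
  apply: (mulfI ba_neq0).
  by rewrite -exprS prednK ?expf_card ?mulr1 // ltnW.
- rewrite -cardE; apply: leq_trans (size_polyD _ _) _.
  rewrite geq_max size_polyX F_gt1 size_polyN.
  apply: leq_trans (size_sum _ _ _) _; apply/bigmax_leqP=> a _.
  rewrite mul_polyC; apply: leq_trans (size_scale_leq _ _) _.
  apply: leq_trans (size_polyD _ _) _.
  rewrite geq_max size_polyN size_poly1 size_exp_XsubC prednK ?leqnn ?andbT //;
    exact: ltnW.
Qed.

(** * The Frobenius map on the group algebra, and idempotents *)

Section Frobenius.

Variables (F : finFieldType) (G : finZmodType) (p k : nat).
Hypotheses (p_pr : prime p) (cardF : #|F| = (p ^ k)%N).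
Local Notation q := #|F|.
Hypothesis inj_mulq : injective (fun x : G => x *+ q).
Local Notation A := (group_alg F G).
Implicit Types (f e : A) (x : G).

Lemma group_alg_exprD f e : (f + e) ^+ q = f ^+ q + e ^+ q.
Proof.
apply: exprDn_pchar; rewrite cardF pnatX pnatE //.
by rewrite (rmorph_pchar (@scalar F G)) // (card_finPcharP cardF).
Qed.

(** Frobenius is additive and fixes the coefficients, so it only multiplies the positions by [q]. *)
Lemma expr_sum_monom f : f ^+ q = \sum_x monom (f x) (x *+ q).
Proof.
have q_gt0 : (0 < q)%N := ltnW (card_finNzRing_gt1 F).
rewrite [in LHS](sum_monom f) (big_morph _ group_alg_exprD (id1 := 0)).
  by apply: eq_bigr => x _; rewrite monomX expf_card.
by rewrite expr0n eqn0Ngt q_gt0.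
Qed.

Lemma expr_cardE f x : (f ^+ q) (x *+ q) = f x.
Proof.
rewrite expr_sum_monom sum_ffunE (bigD1 x) //= ffunE eqxx mulr1n.
rewrite big1 ?addr0 // => y neq_yx.
by rewrite ffunE (inj_eq inj_mulq) eq_sym (negPf neq_yx).
Qed.

Lemma expr_cardXE f x i : (f ^+ (q ^ i)) (x *+ (q ^ i)) = f x.
Proof.
elim: i => [|i IHi]; first by rewrite expr1.
by rewrite expnSr exprM mulrnA expr_cardE.
Qed.

Lemma expr_card_id f : (forall x, f (x *+ q) = f x) -> f ^+ q = f.
Proof.
move=> fq; apply/ffunP=> y.
have [g _ gK] := injF_bij inj_mulq.
by rewrite -(gK y) expr_cardE fq.
Qed.

Lemma idem_mulrn e x : e * e = e -> e (x *+ q) = e x.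
Proof.
move=> ee; rewrite -[RHS]expr_cardE; congr (fun_of_fin _ _).
have F_gt0 : (0 < q)%N := ltnW (card_finNzRing_gt1 F).
rewrite -(prednK F_gt0).
by elim: _.-1 => // i IHi; rewrite exprS -IHi ee.
Qed.

Lemma sum_idem f : (forall x, f (x *+ q) = f x) ->
  exists2 e : F -> A, forall a, e a * e a = e a
                    & f = \sum_a scalar G a * e a.
Proof.
move=> /expr_card_id fq.
exists (fun a => 1 - (f - scalar G a) ^+ q.-1) => [a|].
  set g := f - _; have gq : g ^+ q = g.
    apply: (addIr (scalar G a ^+ q)); rewrite -group_alg_exprD subrK fq.
    by rewrite -rmorphXn /= expf_card subrK.
  have q_gt1 := card_finNzRing_gt1 F.
  (* Here g^(q-1) g^(q-1) = g^(q-2) g^q = g^(q-2) g. *)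
  have gg : g ^+ q.-1 * g ^+ q.-1 = g ^+ q.-1.
    rewrite -{1 3}(subnKC q_gt1) /= exprSr -mulrA -exprS.
    by rewrite prednK ?gq // ltnW.
  by rewrite mulrBr mulr1 mulrBl mul1r gg subrr subr0.
(* The Lagrange identity is carried to polynomials over [A] and evaluated at [f]. *)
have /(congr1 (fun P => (map_poly (@scalar F G) P).[f])) := polyX_lagrange F.
rewrite map_polyX hornerX rmorph_sum horner_sum => def_f.
rewrite [LHS]def_f; apply: eq_bigr => a _.
by rewrite rmorphM rmorphB rmorph1 rmorphXn rmorphB /= map_polyX !map_polyC
  !hornerE.
Qed.

(** The idempotent is kept in the form [h * f] to show that it lies in the ideal generated by [f],
    on which it acts as a unit. *)
Lemma local_unit i f : (0 < i)%N -> (forall x, x *+ (q ^ i) = x) ->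
  exists h, h * f * (h * f) = h * f /\ h * f * f = f.
Proof.
move=> i_gt0 qi.
have qi_gt1 : (1 < q ^ i)%N.
  by rewrite -(exp1n i) ltn_exp2r // card_finNzRing_gt1.
have fqi : f ^+ (q ^ i) = f.
  by apply/ffunP=> x; rewrite -[RHS](expr_cardXE _ x i) qi.
(* With this exponent [h * f * f] is [f ^+ (q ^ i)], that is, [f]. *)
exists (f ^+ (q ^ i - 2)).
have hff : f ^+ (q ^ i - 2) * f * f = f.
  by rewrite -!exprSr -addn2 subnK.
by split; rewrite // mulrCA hff.
Qed.

End Frobenius.

(** * Orbits and multiplication by powers of [q] in Z/n *)

Section Orbits.

Variable n : nat.
Implicit Types (K : {group Zunits n}) (a : Zmod n).

Lemma Zorbit_refl K a : a \in Zorbit K a.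
Proof.
by apply/imsetP; exists 1%g; rewrite ?group1 //= Zp_mulC Zp_mul1z.
Qed.

Lemma Zorbit_mul K a (u : Zunits n) :
  u \in K -> Zorbit K (Zp_mul a (val u)) = Zorbit K a.
Proof.
move=> Ku; apply/setP=> b; apply/imsetP/imsetP=> -[v Kv ->].
  by exists (u * v)%g; rewrite ?groupM //= Zp_mulA.
exists (u^-1 * v)%g; rewrite ?groupM ?groupV // -Zp_mulA.
by congr Zp_mul; rewrite -[RHS]/(val (u * (u^-1 * v))%g) mulKVg.
Qed.

Lemma Zp_mul_nat q (co_nq : coprime n q) a :
  Zp_mul a (val (Zunit_nat co_nq)) = a *+ q.
Proof. by rewrite Zp_mulrn; apply: val_inj; rewrite /= modnMmr. Qed.

Lemma Zp_mul_natX q (co_nq : coprime n q) a i :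
  Zp_mul a (val (Zunit_nat co_nq ^+ i)%g) = a *+ (q ^ i).
Proof.
elim: i a => [|i IHi] a; first by rewrite Zp_mulC Zp_mul1z.
by rewrite expgS [LHS]Zp_mulA Zp_mul_nat IHi expnS mulrnA.
Qed.

End Orbits.

Lemma Zmod_mulrn_totient n q (a : Zmod n) :
  (0 < n)%N -> coprime n q -> a *+ (q ^ totient n) = a.
Proof.
case: n a => // m a _ co_mq; rewrite Zp_mulrn; apply: val_inj => /=.
rewrite -modnMmr Euler_exp_totient 1?coprime_sym //.
by rewrite modnMmr muln1 modn_small.
Qed.

Lemma Zmod_mulrn_inj n q :
  (0 < n)%N -> coprime n q -> injective (fun a : Zmod n => a *+ q).
Proof.
move=> n_gt0 co_nq a b eq_ab.
rewrite -(Zmod_mulrn_totient a n_gt0 co_nq) -(Zmod_mulrn_totient b n_gt0 co_nq).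
have tn_gt0 : (0 < totient n)%N by rewrite totient_gt0.
by rewrite -(prednK tn_gt0) expnS !mulrnA eq_ab.
Qed.

(** * Permutations acting on words and on principal ideals *)

Section PermWords.

Variables (n : nat) (F : finFieldType).
Local Notation A := (group_alg F (Zmod n)).
Implicit Types (f e c : A) (s : {perm Zmod n}) (C : {set {ffun Zmod n -> F}}).

Lemma convolutionE f c : convolution f c = f * c.
Proof. by []. Qed.

Lemma perm_word_mul s f c : (forall x y, f (s x - s y) = f (x - y)) ->
  perm_word s (f * c) = f * perm_word s c.
Proof.
move=> fs; apply/ffunP=> z; rewrite !ffunE (reindex_inj (@perm_inj _ s^-1)) /=.
by apply: eq_bigr => y _; rewrite ffunE -fs !permKV.
Qed.

Lemma perm_wordD s f c : perm_word s (f + c) = perm_word s f + perm_word s c.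
Proof. by apply/ffunP=> x; rewrite !ffunE. Qed.

Lemma perm_word_inj s : injective (@perm_word n F s).
Proof.
move=> f c /ffunP eq_fc; apply/ffunP=> x.
by have := eq_fc (s x); rewrite !ffunE permK.
Qed.

Lemma perm_word_monom s a x : perm_word s (monom a x) = monom a (s x) :> A.
Proof. by apply/ffunP=> y; rewrite !ffunE (canF_eq (permKV s)). Qed.

(** One inclusion suffices: [perm_word s] is injective and [C] is finite. *)
Lemma mem_PAut s C :
  (s \in PAut C) = [forall c in C, perm_word s c \in C].
Proof.
rewrite inE; apply/eqP/forall_inP=> [sC c Cc|sC].
  by rewrite -sC; apply: imset_f.
apply/eqP; rewrite eqEcard card_imset ?leqnn ?andbT; last exact: perm_word_inj.
by apply/subsetP=> _ /imsetP[c Cc ->]; apply: sC.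
Qed.

Definition principal_code e : {set {ffun Zmod n -> F}} :=
  [set e * (f : A) | f : {ffun Zmod n -> F}].

Lemma cyclic_principal_code e : cyclic_code (principal_code e).
Proof.
apply/andP; split; first apply/andP; first split.
- by apply/imsetP; exists 0; rewrite ?mulr0.
- apply/forallP=> a; apply/forall_inP=> _ /imsetP[f _ ->].
  apply/forall_inP=> _ /imsetP[g _ ->]; apply/imsetP.
  exists (scalar _ a * (f : A) + (g : A)) => //; rewrite mulrDr mulrCA.
  by apply/ffunP=> x; rewrite [LHS]ffunE [RHS]ffunE mul_scalar.
apply/forallP=> f; apply/forall_inP=> _ /imsetP[g _ ->]; apply/imsetP.
by exists ((f : A) * g) => //; rewrite mulrCA.
Qed.

Lemma idem_perm s e : e * e = e ->
    (forall C, cyclic_code C -> s \in PAut C) ->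
  forall x y, e (s x - s y) = e (x - y).
Proof.
move=> ee sPAut.
(* The permuted word stays in the ideal of [d], where [d] acts as the identity. *)
have fix_principal d c : d * d = d ->
    d * perm_word s (d * c) = perm_word s (d * c) :> A.
  move=> dd; have := sPAut _ (cyclic_principal_code d).
  rewrite mem_PAut => /forall_inP/(_ (d * c))/(_ (imset_f _ isT)).
  by case/imsetP=> f _ ->; rewrite mulrA dd.
have e_comm c : perm_word s (e * c) = e * perm_word s c :> A.
  have e'e' : (1 - e) * (1 - e) = 1 - e.
    by rewrite mulrBr mulr1 mulrBl mul1r ee subrr subr0.
  have def_c : c = (1 - e) * c + e * c by rewrite -mulrDl subrK mul1r.
  (* Multiplication by [e] kills the permuted [(1 - e)] part of [c] and fixes the permuted [e]
     part. *)
  rewrite [c in RHS]def_c perm_wordD [RHS]mulrDr fix_principal //.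
  rewrite -(fix_principal (1 - e)) // mulrA.
  by rewrite mulrBr mulr1 ee subrr mul0r add0r.
(* Commutation is tested on the unit word at [y], read at position [s x]. *)
move=> x y; have /ffunP/(_ (s x)) := e_comm (monom 1 y).
by rewrite perm_word_monom ffunE permK !conv_monom !mulr1.
Qed.

End PermWords.

(** * The two inclusions between the permutation groups *)

Section MainTheorem.

Variables (q n p k : nat) (F : finFieldType).
Hypotheses (p_pr : prime p) (def_q : q = (p ^ k)%N).
Hypotheses (n_gt0 : (0 < n)%N) (co_nq : coprime n q) (cardF : #|F| = q).
Local Notation A := (group_alg F (Zmod n)).
Implicit Types (s : {perm Zmod n}) (C : {set {ffun Zmod n -> F}}).

Let cardFp : #|F| = (p ^ k)%N.
Proof. by rewrite cardF. Qed.

Let inj_mulq : injective (fun x : Zmod n => x *+ #|F|).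
Proof. by rewrite cardF; apply: Zmod_mulrn_inj. Qed.

Lemma all_PAut_Aut_q s :
  (forall C, cyclic_code C -> s \in PAut C) -> s \in Aut_q co_nq.
Proof.
move=> sPAut; rewrite inE; apply/forallP=> x; apply/forallP=> y.
set K := <[_]>%G.
(* The indicator of the orbit of [y - x]; its value 1 at [s y - s x] will force equal colors. *)
pose f : A := [ffun z => (Zorbit K z == Zorbit K (y - x))%:R].
have [z|e ee def_f] := sum_idem p_pr cardFp inj_mulq (f := f).
  by rewrite !ffunE cardF -(Zp_mul_nat co_nq) Zorbit_mul ?cycle_id.
have : f (s y - s x) = f (y - x).
  rewrite def_f !sum_ffunE; apply: eq_bigr => a _.
  by rewrite !mul_scalar (idem_perm (ee a) sPAut).
rewrite !ffunE eqxx /Cyc; case: eqP => // _ /eqP.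
by rewrite eq_sym oner_eq0.
Qed.

Lemma Aut_q_idem s (e : A) x y :
  s \in Aut_q co_nq -> e * e = e -> e (s x - s y) = e (x - y).
Proof.
rewrite inE => /forallP/(_ y)/forallP/(_ x)/eqP s_yx ee.
(* Equality of colors puts [s x - s y] in the orbit of [x - y], so it is a multiple of [x - y] by
   some [q ^ i], which [e] does not see. *)
have := Zorbit_refl <[Zunit_nat co_nq]>%G (s x - s y).
rewrite -/(Cyc _ _ _) s_yx => /imsetP[_ /cycleP[i ->] ->].
rewrite Zp_mul_natX -cardF; elim: i => // i IHi.
by rewrite expnSr mulrnA (idem_mulrn p_pr cardFp inj_mulq).
Qed.

Lemma Aut_q_PAut s C : s \in Aut_q co_nq -> cyclic_code C -> s \in PAut C.
Proof.
move=> sAut /andP[_ idealC]; rewrite mem_PAut; apply/forall_inP=> c Cc.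
have tn_gt0 : (0 < totient n)%N by rewrite totient_gt0.
have [|h [hc_idem hcc]] := local_unit p_pr cardFp inj_mulq c tn_gt0.
  by move=> x; rewrite cardF Zmod_mulrn_totient.
(* This multiple of [c] is the permuted word itself: [h * c] is idempotent, so it moves inside
   [perm_word s], where [h * c * c = c]. *)
have /forallP/(_ (h * perm_word s c : A))/forall_inP/(_ c Cc) := idealC.
congr (_ \in C); rewrite convolutionE mulrAC.
by rewrite -perm_word_mul ?hcc // => x y; apply: Aut_q_idem.
Qed.

End MainTheorem.

Local Close Scope ring_scope.

Theorem theorem1 (q n : nat)
    (q_prime_power : exists p k : nat, [/\ prime p, 0 < k & q = p ^ k])
    (n_gt0 : 0 < n) (co_nq : coprime n q)
    (F : finFieldType) (cardF : #|F| = q) :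
  \bigcap_(C : {set {ffun Zmod n -> F}} | cyclic_code C) PAut C = Aut_q co_nq.
Proof.
have [p [k [p_pr _ def_q]]] := q_prime_power.
apply/setP=> s; apply/bigcapP/idP=> [sPAut|sAut C cycC].
  exact: all_PAut_Aut_q p_pr def_q n_gt0 _ cardF _ sPAut.
exact: Aut_q_PAut p_pr def_q n_gt0 _ cardF _ _ sAut cycC.
Qed.
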